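(* Let $A,A_*\subset\mathbb{R}$ be finite sets of Szemerédi–Trotter type with the same parameter $\alpha\ge1$ and constants $c(A)$, $c(A_* )$ respectively. Then (for either choice of sign) $$|A\pm A_*| \gg \min\Big\{ c(A_* )^{-\frac{2}{3(7+\alpha)}} c(A)^{-\frac{13}{3(7+\alpha)}} |A_*|^{\frac{2(24-\alpha)}{3(7+\alpha)}} |A|^{\frac{33-10\alpha}{3(7+\alpha)}},\ c(A)^{-\frac{2}{3(7+\alpha)}} c(A_* )^{-\frac{13}{3(7+\alpha)}} |A|^{\frac{2(24-\alpha)}{3(7+\alpha)}} |A_*|^{\frac{33-10\alpha}{3(7+\alpha)}} \Big\}\cdot (\log(|A||A_*|))^{-\frac{2}{7+\alpha}},$$ and, if $\alpha>1$, $$|A\pm A_*| \gg_{(\alpha-1)^{-1}} c(A)^{-\frac{4\alpha-2}{3(\alpha^2+4\alpha-3)}} c(A_* )^{-\frac{7\alpha-5}{3(\alpha^2+4\alpha-3)}} |A|^{\frac{28\alpha-4\alpha^2-16}{3(\alpha^2+4\alpha-3)}} |A_*|^{\frac{35\alpha-4\alpha^2-21}{3(\alpha^2+4\alpha-3)}} (\log(|A||A_*|))^{-\frac{2(\alpha-1)}{\alpha^2+4\alpha-3}} .$$ In particular, for $\alpha=2$, $$|A\pm A_*| \gg \max\Big\{ c(A_* )^{-\frac13} c(A)^{-\frac29}|A_*|^{\frac{11}{9}}|A|^{\frac89},\ c(A)^{-\frac13} c(A_* )^{-\frac29}|A|^{\frac{11}{9}}|A_*|^{\frac89},\ \min\big\{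 c(A_* )^{-\frac{2}{27}} c(A)^{-\frac{13}{27}}|A_*|^{\frac{44}{27}}|A|^{\frac{13}{27}},\ c(A)^{-\frac{2}{27}} c(A_* )^{-\frac{13}{27}}|A|^{\frac{44}{27}}|A_*|^{\frac{13}{27}}\big\}\Big\}\cdot(\log(|A||A_*|))^{-\frac29}.$$ Finally, $$|A\pm A_*|^{\frac{\alpha+1}{2}}\,|A-A| \gg |A|^{\frac{33-4\alpha}{6}} |A_*|^{\frac{6-\alpha}{3}} c(A)^{-7/6} c(A_* )^{-1/3} \log^{-1}(|A||A_*|).$$
   Context: For functions $f,g:\mathbb{R}\to\mathbb{C}$ with finite support, $(f*g)(x)=\sum_y f(y)g(x-y)$; sets are identified with their indicator functions. A finite set $A\subset\mathbb{R}$ has Szemerédi–Trotter type (SzT-type) with parameter $\alpha\ge1$ if there is a constant $c(A)>0$ depending only on $A$ such that for every finite set $B\subset\mathbb{R}$ and every real $\tau\ge1$, $$|\{x\in A+B : (A*B)(x)\ge\tau\}| \ll c(A)\,|B|^{\alpha}\,\tau^{-3},$$ with an absolute implied constant. $A\pm A_*=\{a\pm a_*: a\in A, a_*\in A_*\}$. The symbols $\ll,\gg$ denote inequalities up to absolute positive constants; $\gg_{(\alpha-1)^{-1}}$ means the implied constant may depend on $(\alpha-1)^{-1}$. Logarithms are base 2. *)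

(* Defs.v *)
From HB Require Import structures.
From mathcomp Require Import all_boot all_order all_algebra.
From mathcomp Require Import finmap.
From mathcomp Require Import all_classical all_reals all_analysis.
Set Implicit Arguments.
Unset Strict Implicit.
Unset Printing Implicit Defensive.
Import Order.TTheory GRing.Theory Num.Theory.
Import numFieldNormedType.Exports.
Local Open Scope classical_set_scope.
Local Open Scope ring_scope.

Definition sumset (R : realType) (A B : {fset R}) : {fset R} :=
  [fset (a + b)%R | a in A, b in B]%fset.

Definition diffset (R : realType) (A B : {fset R}) : {fset R} :=
  [fset (a - b)%R | a in A, b in B]%fset.

(* The sum is the library's finitely supported sum, so this is the usual
   convolution whenever f and g have finite support; V may be R or the complex
   numbers over R. *)
Definition convolution (R : realType) (V : pzRingType) (f g : R -> V) (x : R) : V :=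
  \sum_(y \in [set: R]) f y * g (x - y).

Definition setconv (R : realType) (A B : {fset R}) : R -> R :=
  convolution \1_[set` A] \1_[set` B].

(* K is the implied constant of the "<<" in the definition of Szemeredi-Trotter
   type: it has to be fixed independently of A. *)
Definition SzT_type (R : realType) (K alpha c : R) (A : {fset R}) : Prop :=
  [/\ 1 <= alpha, 0 < c &
    forall (B : {fset R}) (tau : R), 1 <= tau ->
      #|` [fset x in sumset A B | (tau <= setconv A B x)%R]%fset|%:R
        <= K * (c * #|` B|%:R `^ alpha * tau ^- 3)].

(* Since ln 0 = ln 1 = 0 and 0 `^ e = 0 for e != 0, the negative powers of
   log2 n are 0 for n = 0 and n = 1: a lower bound with such a factor is trivial
   where it would otherwise divide by zero. *)
Definition log2 (R : realType) (x : R) : R := ln x / ln 2.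

(* Main.v *)
(* Write r_D(x) for the number of representations of x as a difference in D,
   and S = A + B; the case of A - B follows by replacing B with -B, which is
   again of Szemeredi-Trotter type.  For A_x the set of a in A with a - x in A,
   the Katz-Koester inclusion of A_x + B in the intersection of S and S + x,
   with two applications of Cauchy-Schwarz, gives for every weight w >= 0
     (sum_x r_A(x) w(x)^(1/2))^2 |B|^2
       <= (sum_x r_A(x)^2 r_B(x)) (sum_x w(x) r_S(x)).
   Hoelder and a dyadic decomposition bound the first factor, with a single
   logarithm; for w = r_D the second factor is the additive energy of D and S,
   bounded by c(D)^(1/2) |D|^(1/2) |S|^((1+alpha)/2).  What remains is to bound
   the left-hand side from below.
   - For w = r_A, either by the energy of A, or by |A|^6 / |A - A|.  The energies
     of A and B have product at least (|A|^2 |B|^2 / |S|)^2, whence the minimum.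
   - For w = r_B, E(A, B) = sum_x r_A r_B >= |A|^2 |B|^2 / |S|, and the levels
     r_B >= t contribute O(t^(1 - alpha)) (a geometric series, hence the
     dependence on alpha - 1).  For suitable t this is half of the total, and on
     the rest r_B <= t^(1/2) r_B^(1/2). *)
Require Import Defs.
From HB Require Import structures.
From mathcomp Require Import all_boot all_order all_algebra.
From mathcomp Require Import finmap.
From mathcomp Require Import all_classical all_reals all_analysis.
From mathcomp Require Import ring lra.
Set Implicit Arguments.
Unset Strict Implicit.
Unset Printing Implicit Defensive.
Import Order.TTheory GRing.Theory Num.Theory.
Import numFieldNormedType.Exports.
Local Open Scope ring_scope.

(** * Finite sums: Cauchy-Schwarz, Hoelder, and moments under weak cubic decay *)

Section FiniteSums.
Variables (R : realType) (T : eqType).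
Implicit Types (s : seq T) (f g : T -> R).

(** Lagrange's identity: the double sum of the squares [(f x * g y - f y * g x) ^+ 2] is twice the
    difference of the two sides. *)
Lemma cauchy_schwarz_sum s f g :
  (\sum_(x <- s) f x * g x) ^+ 2
    <= (\sum_(x <- s) f x ^+ 2) * (\sum_(x <- s) g x ^+ 2).
Proof.
have: 0 <= \sum_(x <- s) \sum_(y <- s) (f x * g y - f y * g x) ^+ 2.
  by apply: sumr_ge0 => x _; apply: sumr_ge0 => y _; exact: sqr_ge0.
have -> : \sum_(x <- s) \sum_(y <- s) (f x * g y - f y * g x) ^+ 2 =
   2 * ((\sum_(x <- s) f x ^+ 2) * (\sum_(x <- s) g x ^+ 2)
        - (\sum_(x <- s) f x * g x) ^+ 2).
  have e x y : (f x * g y - f y * g x) ^+ 2 =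
     f x ^+ 2 * g y ^+ 2 + f y ^+ 2 * g x ^+ 2 - 2 * (f x * g x * (f y * g y)).
    by ring.
  under eq_bigr do under eq_bigr do rewrite e.
  under eq_bigr do rewrite !big_split /= -mulr_sumr -mulr_suml sumrN -!mulr_sumr.
  rewrite !big_split /= -mulr_suml -mulr_sumr sumrN -!mulr_sumr -mulr_suml.
  ring.
by rewrite pmulr_rge0 // subr_ge0.
Qed.

(** Two Cauchy-Schwarz steps: with [Y] the sum of [f * g ^+ 2], [X ^+ 2 <= F * Y] and
    [Y ^+ 2 <= X * G], so [X ^+ 4 <= F ^+ 2 * (X * G)] and one [X] cancels. *)
Lemma holder_sum s f g : (forall x, 0 <= f x) -> (forall x, 0 <= g x) ->
  (\sum_(x <- s) f x ^+ 2 * g x) ^+ 3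
    <= (\sum_(x <- s) f x ^+ 3) ^+ 2 * \sum_(x <- s) g x ^+ 3.
Proof.
move=> f0 g0.
set X := \sum_(x <- s) f x ^+ 2 * g x; set F := \sum_(x <- s) f x ^+ 3.
set G := \sum_(x <- s) g x ^+ 3.
pose Y := \sum_(x <- s) f x * g x ^+ 2.
have X0 : 0 <= X by apply: sumr_ge0 => x _; rewrite mulr_ge0 ?exprn_ge0.
have Y0 : 0 <= Y by apply: sumr_ge0 => x _; rewrite mulr_ge0 ?exprn_ge0.
have F0 : 0 <= F by apply: sumr_ge0 => x _; rewrite exprn_ge0.
have G0 : 0 <= G by apply: sumr_ge0 => x _; rewrite exprn_ge0.
have XY : X ^+ 2 <= F * Y.
  have := cauchy_schwarz_sum s (fun x => f x * Num.sqrt (f x))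
            (fun x => Num.sqrt (f x) * g x).
  congr (_ ^+ 2 <= _ * _); apply: eq_bigr => x _;
    have := sqr_sqrtr (f0 x); set r := Num.sqrt _ => <-; ring.
have YX : Y ^+ 2 <= X * G.
  have := cauchy_schwarz_sum s (fun x => f x * Num.sqrt (g x))
            (fun x => Num.sqrt (g x) * g x).
  congr (_ ^+ 2 <= _ * _); apply: eq_bigr => x _;
    have := sqr_sqrtr (g0 x); set r := Num.sqrt _ => <-; ring.
have [->|Xn0] := eqVneq X 0; first by rewrite expr0n mulr_ge0 ?exprn_ge0.
have Xp : 0 < X by rewrite lt0r Xn0.
rewrite -(ler_pM2r Xp) -exprSr.
have -> : X ^+ 4 = (X ^+ 2) ^+ 2 by rewrite -exprM.
apply: (@le_trans _ _ ((F * Y) ^+ 2)).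
  by rewrite ler_sqr // nnegrE ?exprn_ge0 ?mulr_ge0.
rewrite exprMn.
have -> : F ^+ 2 * G * X = F ^+ 2 * (X * G) by ring.
by rewrite ler_wpM2l ?exprn_ge0.
Qed.

(** The layers are nested, so when [t <= u] the largest [j] with [2 ^+ j * t <= u] suffices: there
    [u < 2 ^+ j.+1 * t], and the other terms are nonnegative. *)
Lemma dyadic_layers (p J : nat) (t u : R) : 0 < t -> u < 2 ^+ J * t ->
  (t <= u)%R%:R * u ^+ p
    <= \sum_(j < J) (2 ^+ j.+1 * t) ^+ p * (2 ^+ j * t <= u)%R%:R.
Proof.
move=> t0; have p0 k : 0 <= 2 ^+ k * t by rewrite mulr_ge0 ?exprn_ge0 // ltW.
elim: J => [|J IH] uJ.
  by rewrite expr0 mul1r in uJ; rewrite big_ord0 (lt_geF uJ) mul0r lexx.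
rewrite big_ord_recr /=; have [h|h] := ltP u (2 ^+ J * t).
  by rewrite mulr0 addr0 IH.
rewrite -[leLHS]add0r lerD ?sumr_ge0 // => [i _|].
  by rewrite mulr_ge0 ?ler0n // exprn_ge0.
have u0 : 0 <= u by exact: le_trans (p0 J) h.
rewrite mulr1; apply: (@le_trans _ _ (u ^+ p)).
  by case: (t <= u); rewrite ?mul1r // mul0r exprn_ge0.
by rewrite lerXn2r ?nnegrE // ltW.
Qed.

Lemma dyadic_bound (N t : R) : 0 < t -> exists J : nat, N < 2 ^+ J * t.
Proof.
move=> t0; exists (Num.truncn (N / t)).+1.
rewrite -ltr_pdivrMr //; apply: lt_trans (truncnS_gt _) _.
by rewrite -natrX ltr_nat ltn_expl.
Qed.

Lemma dyadic_sum (p J : nat) (t : R) s f g : 0 < t ->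
  (forall x, 0 <= g x) -> (forall x, f x < 2 ^+ J * t) ->
  \sum_(x <- s) (t <= f x)%R%:R * (g x * f x ^+ p)
    <= \sum_(j < J) (2 ^+ j.+1 * t) ^+ p
         * \sum_(x <- s) g x * (2 ^+ j * t <= f x)%R%:R.
Proof.
move=> t0 g0 fJ.
under [leRHS]eq_bigr do rewrite mulr_sumr.
rewrite exchange_big /=; apply: ler_sum => x _.
rewrite mulrCA; under eq_bigr do rewrite mulrCA.
by rewrite -mulr_sumr ler_wpM2l // dyadic_layers.
Qed.

Lemma geometric_sum_le (x : R) (J : nat) : 0 <= x -> x < 1 ->
  \sum_(j < J) x ^+ j <= (1 - x)^-1.
Proof.
move=> x0 x1; have x1' : 0 < 1 - x by rewrite subr_gt0.
rewrite -(ler_pM2l x1') mulfV ?gt_eqF //.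
have -> : (1 - x) * \sum_(j < J) x ^+ j = 1 - x ^+ J.
  by rewrite -opprB mulNr -subrX1 opprB.
by rewrite gerBl exprn_ge0.
Qed.

(** A weak L^3 bound, [M] bounding the cube of the weak norm; this is the shape that
    Szemeredi-Trotter type gives to representation functions. *)
Definition weak_cube s f (M : R) :=
  forall t : R, 0 < t -> \sum_(x <- s) (t <= f x)%R%:R <= M * t ^- 3.

Lemma weak_cube_layers (p J : nat) s f (M t : R) : weak_cube s f M -> 0 < t ->
  (forall x, f x < 2 ^+ J * t) ->
  \sum_(x <- s) (t <= f x)%R%:R * f x ^+ p
    <= \sum_(j < J) (2 ^+ j.+1 * t) ^+ p * (M * (2 ^+ j * t) ^- 3).
Proof.
move=> fM t0 fJ.
have := @dyadic_sum p J t s f (fun=> 1) t0 (fun=> ler01) fJ.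
under eq_bigr do rewrite mul1r.
move=> /le_trans; apply; apply: ler_sum => j _.
under eq_bigr do rewrite mul1r.
by rewrite ler_wpM2l ?fM ?exprn_ge0 ?mulr_ge0 ?exprn_ge0 ?mulr_gt0 ?exprn_gt0 // ltW.
Qed.

Variables (s : seq T) (f : T -> R) (M N : R).
Hypotheses (M0 : 0 <= M) (fM : weak_cube s f M) (fN : forall x, f x <= N).

Lemma weak_cube_tail1 (t : R) : 0 < t ->
  \sum_(x <- s) (t <= f x)%R%:R * f x <= 4 * M * t ^- 2.
Proof.
move=> t0; have [J NJ] := dyadic_bound N t0.
have := weak_cube_layers 1 fM t0 (fun x => le_lt_trans (fN x) NJ).
under eq_bigr do rewrite expr1.
move=> /le_trans; apply.
(* Height to the power 1 against a count of power -3: layers decay by a factor 4, and the series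
   gives 8/3, rounded up to 4. *)
have e (j : 'I_J) : (2 ^+ j.+1 * t) ^+ 1 * (M * (2 ^+ j * t) ^- 3) =
    2 * M * t ^- 2 * (4^-1) ^+ j.
  have -> : (4^-1 : R) ^+ j = ((2 ^+ j) ^-1) ^+ 2.
    by rewrite exprVn -exprM mulnC exprM exprVn; congr (_ ^+ _)^-1; ring.
  have : 2 ^+ j != 0 :> R by rewrite expf_neq0.
  rewrite (exprS 2 j); set r := 2 ^+ j => r0; field.
  by rewrite r0 gt_eqF.
under eq_bigr do rewrite e.
rewrite -mulr_sumr.
apply: (@le_trans _ _ (2 * M * t ^- 2 * (1 - 4^-1)^-1)).
  apply: ler_wpM2l; last by apply: geometric_sum_le; lra.
  by rewrite !mulr_ge0 ?invr_ge0 ?exprn_ge0 // ltW.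
have : 0 <= M * t ^- 2 by rewrite mulr_ge0 ?invr_ge0 ?exprn_ge0 // ltW.
have -> : (1 - 4^-1)^-1 = 4 / 3 :> R by field.
lra.
Qed.

Lemma weak_cube_tail2 (t : R) : 0 < t ->
  \sum_(x <- s) (t <= f x)%R%:R * f x ^+ 2 <= 8 * M * t^-1.
Proof.
move=> t0; have [J NJ] := dyadic_bound N t0.
apply: (le_trans (weak_cube_layers 2 fM t0 (fun x => le_lt_trans (fN x) NJ))).
have e (j : 'I_J) : (2 ^+ j.+1 * t) ^+ 2 * (M * (2 ^+ j * t) ^- 3) =
    4 * M * t^-1 * (2^-1) ^+ j.
  have : 2 ^+ j != 0 :> R by rewrite expf_neq0.
  rewrite exprVn (exprS 2 j); set r := 2 ^+ j => r0; field.
  by rewrite r0 gt_eqF.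
under eq_bigr do rewrite e.
rewrite -mulr_sumr.
apply: (@le_trans _ _ (4 * M * t ^- 1 * (1 - 2^-1)^-1)).
  apply: ler_wpM2l; last by apply: geometric_sum_le; lra.
  by rewrite !mulr_ge0 ?invr_ge0 ?exprn_ge0 // ltW.
have : 0 <= M * t ^- 1 by rewrite mulr_ge0 ?invr_ge0 ?exprn_ge0 // ltW.
have -> : (1 - 2^-1)^-1 = 2 :> R by field.
rewrite expr1.
lra.
Qed.

(** At the critical exponent 3 every layer contributes the same [8 * M], so the number of layers
    appears; this is the source of the logarithm. The gap between 0 and 1 lets the layers start at
    height 1. *)
Lemma weak_cube_sum3 (J : nat) : (forall x, f x = 0 \/ 1 <= f x) ->
  (forall x, f x < 2 ^+ J) -> \sum_(x <- s) f x ^+ 3 <= 8 * M * J%:R.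
Proof.
move=> f01 fJ.
have fJ' x : f x < 2 ^+ J * 1 by rewrite mulr1.
have := weak_cube_layers 3 fM ltr01 fJ'.
under eq_bigr => x _.
  have -> : (1 <= f x)%R%:R * f x ^+ 3 = f x ^+ 3.
    by case: (f01 x) => [->|->]; rewrite ?mul1r // expr0n mulr0.
  over.
move=> /le_trans; apply.
have e (j : 'I_J) : (2 ^+ j.+1 * 1) ^+ 3 * (M * (2 ^+ j * 1) ^- 3) = 8 * M.
  have : 2 ^+ j != 0 :> R by rewrite expf_neq0.
  by rewrite (exprS 2 j); set r := 2 ^+ j => r0; field.
under eq_bigr do rewrite e.
by rewrite sumr_const card_ord mulr_natr.
Qed.

Hypothesis f0 : forall x, 0 <= f x.

(* The cut-off t is chosen so that the tail above t is at most half of the sum;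
   the part below t then dominates. *)
Lemma weak_cube_sum1 : (\sum_(x <- s) f x) ^+ 3 <= 32 * (size s)%:R ^+ 2 * M.
Proof.
set Z := \sum_(x <- s) f x.
have Z0 : 0 <= Z by exact: sumr_ge0.
have [->|Zn0] := eqVneq Z 0; first by rewrite expr0n !mulr_ge0 ?exprn_ge0.
have Zp : 0 < Z by rewrite lt0r Zn0.
have split t : 0 < t -> Z <= t * (size s)%:R + 4 * M * t ^- 2.
  move=> t0; have := weak_cube_tail1 t0; rewrite -(lerD2l (t * (size s)%:R)).
  apply: le_trans; rewrite -[X in t * X%:R](count_predT s) -sum1_count natr_sum.
  rewrite mulr_sumr -big_split /=.
  apply: ler_sum => x _; rewrite mulr1; case: (leP t (f x)) => h.
    by rewrite mul1r lerDr ltW.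
  by rewrite mul0r addr0 ltW.
(* For [M = 0] the cut-off chosen below would be 0; a small positive one already gives
   [Z <= Z / 2]. *)
have [M00|Mn0] := eqVneq M 0.
  have : Z <= Z / 2.
    have := split (Z / 2 / ((size s)%:R + 1)).
    have p : 0 < (size s)%:R + 1 :> R by rewrite ltr_wpDl.
    rewrite divr_gt0 ?divr_gt0 // => /(_ isT); rewrite M00 mulr0 mul0r addr0.
    move=> /le_trans; apply; rewrite mulrAC ler_pdivrMr //.
    by rewrite ler_wpM2l ?lerDl // divr_ge0.
  lra.
have Mp : 0 < M by rewrite lt0r Mn0.
pose t := Num.sqrt (8 * M / Z).
have t2 : t ^+ 2 = 8 * M / Z by rewrite sqr_sqrtr // divr_ge0 ?mulr_ge0.
have t0 : 0 < t by rewrite sqrtr_gt0 divr_gt0 ?mulr_gt0.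
have := split t t0; rewrite t2.
have -> : 4 * M * (8 * M / Z)^-1 = Z / 2 by field; rewrite !gt_eqF.
move=> h; have h2 : Z / 2 <= t * (size s)%:R by lra.
have : (Z / 2) ^+ 2 <= (t * (size s)%:R) ^+ 2.
  by rewrite ler_sqr // nnegrE ?divr_ge0 ?mulr_ge0 // ltW.
rewrite [leRHS]exprMn t2 -(ler_pM2l Zp).
have -> : Z * (8 * M / Z * (size s)%:R ^+ 2) = 8 * M * (size s)%:R ^+ 2.
  by field; rewrite gt_eqF.
have -> : Z * (Z / 2) ^+ 2 = Z ^+ 3 / 4 by field.
lra.
Qed.

(** Below a cut-off [t], [f ^+ 2 <= t * f]; the choice [t = 16 * M / W] makes the tail bound equal
    to [W / 2]. *)
Lemma weak_cube_sum2 :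
  (\sum_(x <- s) f x ^+ 2) ^+ 2 <= 32 * M * \sum_(x <- s) f x.
Proof.
set W := \sum_(x <- s) f x ^+ 2; set Z := \sum_(x <- s) f x.
have Z0 : 0 <= Z by exact: sumr_ge0.
have W0 : 0 <= W by apply: sumr_ge0 => x _; exact: sqr_ge0.
have [->|Wn0] := eqVneq W 0; first by rewrite expr0n !mulr_ge0.
have Wp : 0 < W by rewrite lt0r Wn0.
have split t : 0 < t -> W <= t * Z + 8 * M * t^-1.
  move=> t0; have := weak_cube_tail2 t0; rewrite -(lerD2l (t * Z)).
  apply: le_trans; rewrite mulr_sumr -big_split /=.
  apply: ler_sum => x _; case: (leP t (f x)) => h.
    by rewrite mul1r lerDr mulr_ge0 // ltW.
  by rewrite mul0r addr0 expr2 ler_wpM2r // ltW.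
have [M00|Mn0] := eqVneq M 0.
  have : W <= W / 2.
    have := split (W / 2 / (Z + 1)).
    have p : 0 < Z + 1 by rewrite ltr_wpDl.
    rewrite divr_gt0 ?divr_gt0 // => /(_ isT); rewrite M00 mulr0 mul0r addr0.
    move=> /le_trans; apply; rewrite mulrAC ler_pdivrMr //.
    by rewrite ler_wpM2l ?lerDl // divr_ge0.
  lra.
have Mp : 0 < M by rewrite lt0r Mn0.
have t0 : 0 < 16 * M / W by rewrite divr_gt0 ?mulr_gt0.
have := split _ t0.
have -> : 8 * M * (16 * M / W)^-1 = W / 2 by field; rewrite !gt_eqF.
rewrite -(ler_pM2l Wp).
have -> : W * (16 * M / W * Z + W / 2) = 16 * M * Z + W ^+ 2 / 2.
  by field; rewrite !gt_eqF.
rewrite -expr2; lra.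
Qed.

(** Interpolation between the exponent 3/2 and weak L^3: below the cut-off,
    [f ^+ 2 <= Num.sqrt t * (f * Num.sqrt f)], and [t = 16 * M / E] makes the tail bound [E / 2]. It
    serves to bound the 3/2-moment from below by the energy. *)
Lemma weak_cube_sum32 :
  (\sum_(x <- s) f x ^+ 2) ^+ 3
    <= 64 * M * (\sum_(x <- s) f x * Num.sqrt (f x)) ^+ 2.
Proof.
set E := \sum_(x <- s) f x ^+ 2; set Q := \sum_(x <- s) f x * Num.sqrt (f x).
have Q0 : 0 <= Q by apply: sumr_ge0 => x _; rewrite mulr_ge0.
have E0 : 0 <= E by apply: sumr_ge0 => x _; exact: sqr_ge0.
have [->|En0] := eqVneq E 0; first by rewrite expr0n !mulr_ge0 ?exprn_ge0.
have Ep : 0 < E by rewrite lt0r En0.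
have split t : 0 < t -> E <= Num.sqrt t * Q + 8 * M * t^-1.
  move=> t0; have := weak_cube_tail2 t0; rewrite -(lerD2l (Num.sqrt t * Q)).
  apply: le_trans; rewrite mulr_sumr -big_split /=.
  apply: ler_sum => x _; case: (leP t (f x)) => h.
    by rewrite mul1r lerDr !mulr_ge0.
  rewrite mul0r addr0; have := sqr_sqrtr (f0 x).
  have : Num.sqrt (f x) <= Num.sqrt t by rewrite ler_sqrt // ltW.
  have := sqrtr_ge0 (f x); set r := Num.sqrt (f x) => r0 rt <-.
  have -> : (r ^+ 2) ^+ 2 = r * (r ^+ 2 * r) by ring.
  by rewrite ler_wpM2r // mulr_ge0 ?exprn_ge0.
have [M00|Mn0] := eqVneq M 0.
  have : E <= E / 2.
    have p : 0 < Q + 1 by rewrite ltr_wpDl.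
    have u0 : 0 < E / 2 / (Q + 1) by rewrite !divr_gt0.
    have := split _ (exprn_gt0 2 u0).
    rewrite sqrtr_sqr gtr0_norm // M00 mulr0 mul0r addr0.
    move=> /le_trans; apply; rewrite mulrAC ler_pdivrMr //.
    by rewrite ler_wpM2l ?lerDl // divr_ge0.
  lra.
have Mp : 0 < M by rewrite lt0r Mn0.
have t0 : 0 < 16 * M / E by rewrite divr_gt0 ?mulr_gt0.
have := split _ t0.
have -> : 8 * M * (16 * M / E)^-1 = E / 2 by field; rewrite !gt_eqF.
have := sqr_sqrtr (ltW t0); set r := Num.sqrt _ => r2 h.
have h2 : E / 2 <= r * Q by lra.
have : (E / 2) ^+ 2 <= (r * Q) ^+ 2.
  by rewrite ler_sqr // nnegrE ?divr_ge0 ?mulr_ge0 ?sqrtr_ge0.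
rewrite [leRHS]exprMn r2 -(ler_pM2l Ep).
have -> : E * (16 * M / E * Q ^+ 2) = 16 * M * Q ^+ 2.
  by field; rewrite gt_eqF.
have -> : E * (E / 2) ^+ 2 = E ^+ 3 / 4 by field.
lra.
Qed.

End FiniteSums.

(** * Representation functions, additive energy and the Katz-Koester inequality *)

Section Representations.
Variable R : realType.
Implicit Types (A B U P : {fset R}) (F : R -> R).

Definition sumrep A B (x : R) : R := \sum_(a <- A) \sum_(b <- B) (a + b == x)%:R.

Definition diffrep A (x : R) : R := \sum_(a <- A) \sum_(b <- A) (a - b == x)%:R.

Definition oppset A : {fset R} := [fset - a | a in A]%fset.

Lemma sum_eq_op U (u : R) F :
  \sum_(x <- U) (u == x)%:R * F x = (u \in U)%:R * F u.
Proof.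
have [uU|uU] := boolP (u \in U).
  rewrite (big_fsetD1 u) //= eqxx big_seq big1 ?addr0 // => x.
  by rewrite in_fsetD1 eq_sym => /andP[/negbTE -> _]; rewrite mul0r.
rewrite mul0r big_seq big1 // => x xU.
by case: eqP uU => [->|]; rewrite ?xU // mul0r.
Qed.

Lemma natr_card A : #|` A|%:R = \sum_(a <- A) 1 :> R.
Proof. by rewrite -sum1_size natr_sum. Qed.

Lemma sum_oppset A F : \sum_(x <- oppset A) F x = \sum_(a <- A) F (- a).
Proof. by rewrite big_imfset //= => x y _ _; exact: oppr_inj. Qed.

Lemma card_oppset A : #|` oppset A| = #|` A|.
Proof. by rewrite card_imfset //; exact: oppr_inj. Qed.

Lemma mem_sumset A B a b : a \in A -> b \in B -> a + b \in sumset A B.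
Proof. by move=> aA bB; apply/imfset2P; exists a => //; exists b. Qed.

Lemma mem_diffset A B a b : a \in A -> b \in B -> a - b \in diffset A B.
Proof. by move=> aA bB; apply/imfset2P; exists a => //; exists b. Qed.

Lemma sumsetC A B : sumset A B = sumset B A.
Proof.
by apply/fsetP => x; apply/imfset2P/imfset2P => -[a aA [b bB ->]];
  exists b => //; exists a => //; rewrite addrC.
Qed.

Lemma diffset_sumset A B : diffset A B = sumset A (oppset B).
Proof.
apply/fsetP => x; apply/imfset2P/imfset2P => -[a aA [b bB ->]]; exists a => //.
  by exists (- b) => //=; apply/imfsetP; exists b.
by case/imfsetP: bB => c /= cB ->; exists c.
Qed.

Lemma setconvE A B x : setconv A B x = sumrep A B x.
Proof.
rewrite /setconv /convolution (fsbigTE A) => [|y yA]; last first.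
  by rewrite indicE memNset ?mul0r //; exact/negP.
rewrite /sumrep big_seq [RHS]big_seq; apply: eq_bigr => a aA.
rewrite !indicE mem_set // mul1r.
transitivity ((x - a \in B)%:R * (1 : R)).
  rewrite mulr1; congr (_%:R); congr nat_of_bool.
  by apply/idP/idP => [/set_mem|/mem_set].
rewrite -(sum_eq_op B (x - a) (fun=> 1)); apply: eq_bigr => b _.
by rewrite mulr1 subr_eq addrC eq_sym.
Qed.

Lemma sumrep_ge0 A B x : 0 <= sumrep A B x.
Proof. by apply: sumr_ge0 => a _; apply: sumr_ge0. Qed.

Lemma sumrep_nat A B x : sumrep A B x = 0 \/ 1 <= sumrep A B x.
Proof.
have -> : sumrep A B x = (\sum_(a <- A) \sum_(b <- B) (a + b == x)%R)%N%:R.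
  by rewrite natr_sum; apply: eq_bigr => a _; rewrite natr_sum.
by case: (\sum_(a <- A) _)%N => [|n]; [left|right; rewrite ler1n].
Qed.

Lemma sumrep_notin A B x : x \notin sumset A B -> sumrep A B x = 0.
Proof.
move=> xS; rewrite /sumrep big_seq big1 // => a aA; rewrite big_seq big1 // => b bB.
by case: eqP xS => // <-; rewrite mem_sumset.
Qed.

Lemma sumrep_le A B x : sumrep A B x <= #|` A|%:R.
Proof.
rewrite natr_card; apply: ler_sum => a _.
rewrite (_ : \sum_(b <- B) _ = (x - a \in B)%:R); first by case: (_ \in _).
rewrite -[RHS]mulr1 -(sum_eq_op B (x - a) (fun=> 1)); apply: eq_bigr => b _.
by rewrite mulr1 subr_eq addrC eq_sym.
Qed.

Lemma diffrepE A x : diffrep A x = sumrep A (oppset A) x.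
Proof. by apply: eq_bigr => a _; rewrite sum_oppset. Qed.

Lemma diffrep_mem A x : diffrep A x = \sum_(a <- A) (a - x \in A)%:R.
Proof.
apply: eq_bigr => a _; rewrite -[RHS]mulr1 -(sum_eq_op A (a - x) (fun=> 1)).
by apply: eq_bigr => b _; rewrite mulr1 !subr_eq addrC.
Qed.

Lemma diffrep_ge0 A x : 0 <= diffrep A x.
Proof. by rewrite diffrepE sumrep_ge0. Qed.

Lemma sumrep_oppset A B x : sumrep (oppset A) B x = sumrep A (oppset B) (- x).
Proof.
rewrite /sumrep sum_oppset; apply: eq_bigr => a _; rewrite sum_oppset.
by apply: eq_bigr => b _; rewrite -eqr_opp opprD opprK.
Qed.

Lemma sum_sumrep A B U F : {subset sumset A B <= U} ->
  \sum_(x <- U) sumrep A B x * F x = \sum_(a <- A) \sum_(b <- B) F (a + b).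
Proof.
move=> sU; under eq_bigr do rewrite mulr_suml.
rewrite exchange_big /= big_seq [RHS]big_seq; apply: eq_bigr => a aA.
under eq_bigr do rewrite mulr_suml.
rewrite exchange_big /= big_seq [RHS]big_seq; apply: eq_bigr => b bB.
by rewrite sum_eq_op sU ?mul1r // mem_sumset.
Qed.

Lemma sum_diffrep A U F : {subset diffset A A <= U} ->
  \sum_(x <- U) diffrep A x * F x = \sum_(a <- A) \sum_(b <- A) F (a - b).
Proof.
rewrite diffset_sumset => sU; under eq_bigr do rewrite diffrepE.
by rewrite sum_sumrep //; apply: eq_bigr => a _; rewrite sum_oppset.
Qed.

Lemma sum_sumrep1 A B U : {subset sumset A B <= U} ->
  \sum_(x <- U) sumrep A B x = #|` A|%:R * #|` B|%:R.
Proof.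
move=> sU; have := sum_sumrep (fun=> 1) sU; under eq_bigr do rewrite mulr1.
move=> ->; rewrite !natr_card mulr_suml.
by apply: eq_bigr => a _; rewrite mul1r.
Qed.

(** The additive energy: the number of quadruples with [a + b = a' + b']. *)
Definition energy A B : R := \sum_(a <- A) \sum_(b <- B) sumrep A B (a + b).

Lemma energy_sumrep A B U : {subset sumset A B <= U} ->
  \sum_(x <- U) sumrep A B x ^+ 2 = energy A B.
Proof. by move=> sU; rewrite /energy -(sum_sumrep (sumrep A B) sU). Qed.

(** The equation [a + b = a' + b'] can be read as [a - a' = b' - b]. *)
Lemma energy_diffrep A B U : {subset diffset A A <= U} ->
  \sum_(x <- U) diffrep A x * diffrep B x = energy A B.
Proof.
move=> sU; rewrite sum_diffrep // /energy; apply: eq_bigr => a _.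
rewrite /sumrep [RHS]exchange_big /=; apply: eq_bigr => a' _; rewrite /diffrep.
rewrite [RHS]exchange_big /=; apply: eq_bigr => b _; apply: eq_bigr => b' _.
by rewrite subr_eq addrAC eq_sym subr_eq eq_sym [b + a']addrC.
Qed.

Lemma energy_ge A B :
  (#|` A|%:R * #|` B|%:R) ^+ 2 <= #|` sumset A B|%:R * energy A B.
Proof.
have sS : {subset sumset A B <= sumset A B} by [].
rewrite -(energy_sumrep sS) -(sum_sumrep1 sS).
have := cauchy_schwarz_sum (sumset A B) (fun=> 1) (sumrep A B).
under eq_bigr do rewrite mul1r; under [X in X * _]eq_bigr do rewrite expr1n.
by rewrite natr_card.
Qed.

(** Reading [a - b = p] as [b + p = a] makes [P] a second summand, to which the Szemeredi-Trotter
    hypothesis on [A] can be applied. *)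
Lemma sum_popular_diffrep A P :
  \sum_(x <- P) diffrep A x = \sum_(y <- A) sumrep A P y.
Proof.
rewrite /diffrep exchange_big /=; apply: eq_bigr => a _.
rewrite exchange_big /=; apply: eq_bigr => b _.
by apply: eq_bigr => p _; rewrite subr_eq [p + b]addrC eq_sym.
Qed.

(** The set A_x of the Katz-Koester argument, the intersection of A and A + x. *)
Definition fiber A (x : R) : {fset R} := [fset a in A | a - x \in A]%fset.

Lemma mem_fiber A x a : (a \in fiber A x) = (a \in A) && (a - x \in A).
Proof. by rewrite !inE. Qed.

Lemma sum_fiber A x F :
  \sum_(a <- fiber A x) F a = \sum_(a <- A) (a - x \in A)%:R * F a.
Proof.
rewrite /fiber -big_fset_condE big_mkcond /=; apply: eq_bigr => a _.
by case: (_ \in _); rewrite ?mul1r ?mul0r.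
Qed.

Lemma card_fiber A x : #|` fiber A x|%:R = diffrep A x.
Proof.
rewrite natr_card sum_fiber diffrep_mem.
by apply: eq_bigr => a _; rewrite mulr1.
Qed.

(** The Katz-Koester inclusion: for [a] in the fiber, both [a + b] and [a + b - x = (a - x) + b] lie
    in [sumset A B]. *)
Lemma card_sumset_fiber A B x :
  #|` sumset (fiber A x) B|%:R <= diffrep (sumset A B) x.
Proof.
rewrite -card_fiber ler_nat; apply: fsubset_leq_card.
apply/fsubsetP => y /imfset2P[a /=]; rewrite mem_fiber => /andP[aA axA] [b bB ->].
rewrite mem_fiber; apply/andP; split; first exact: mem_sumset.
by rewrite addrAC mem_sumset.
Qed.

(** Both sides are the sum of r_A(a - a') r_B(a - a') over a, a' in A: on the left, a pair
    contributes r_B(a - a') once for each x with a - x and a' - x in A, and there are r_A(a - a')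
    such x. *)
Lemma sum_energy_fiber A B U : {subset diffset A A <= U} ->
  \sum_(x <- U) energy (fiber A x) B
    = \sum_(x <- U) diffrep A x ^+ 2 * diffrep B x.
Proof.
move=> sU; under [RHS]eq_bigr do rewrite expr2 -mulrA.
rewrite (sum_diffrep (fun x => diffrep A x * diffrep B x)) //.
under eq_bigr do rewrite /energy sum_fiber.
rewrite exchange_big /= big_seq [RHS]big_seq; apply: eq_bigr => a aA.
transitivity (\sum_(x <- U) \sum_(a' <- A) (a - x \in A)%:R *
    ((a' - x \in A)%:R * diffrep B (a - a'))).
  apply: eq_bigr => x _; rewrite -mulr_sumr; congr (_ * _).
  rewrite exchange_big /= sum_fiber; apply: eq_bigr => a' _; congr (_ * _).
  rewrite exchange_big /= /diffrep; apply: eq_bigr => b _; apply: eq_bigr => b' _.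
  by symmetry; rewrite subr_eq addrAC eq_sym subr_eq eq_sym [b + a']addrC.
rewrite exchange_big /=; apply: eq_bigr => a' _.
under eq_bigr do rewrite mulrA.
rewrite -mulr_suml; congr (_ * _); rewrite diffrep_mem.
(* Expanding the indicator over [c = a - x] lets the sum over [x] collapse to [x = a - c], where
   [a' - x = c - (a - a')]. *)
under eq_bigr => x _.
  rewrite -[X in X * _]mulr1 -(sum_eq_op A (a - x) (fun=> 1)) mulr_suml; over.
rewrite exchange_big /= big_seq [RHS]big_seq; apply: eq_bigr => c cA.
transitivity (\sum_(x <- U) (a - c == x)%:R * (a' - x \in A)%:R : R).
  by apply: eq_bigr => x _; rewrite mulr1 subr_eq [in RHS]subr_eq addrC.
rewrite (sum_eq_op U (a - c) (fun x => (a' - x \in A)%:R)) sU ?mem_diffset //.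
by rewrite mul1r !opprB addrCA.
Qed.

(** [energy_ge] for the pair A_x, B, followed by the Katz-Koester inclusion. *)
Lemma card_fiber_le A B x :
  (diffrep A x * #|` B|%:R) ^+ 2 <= diffrep (sumset A B) x * energy (fiber A x) B.
Proof.
rewrite -card_fiber; apply: le_trans (energy_ge _ _) _.
rewrite ler_wpM2r ?card_sumset_fiber //.
by apply: sumr_ge0 => a _; apply: sumr_ge0 => b _; exact: sumrep_ge0.
Qed.

Lemma katz_koester A B U (w : R -> R) : {subset diffset A A <= U} ->
  (forall x, 0 <= w x) ->
  (\sum_(x <- U) diffrep A x * Num.sqrt (w x)) ^+ 2 * #|` B|%:R ^+ 2
    <= (\sum_(x <- U) diffrep A x ^+ 2 * diffrep B x)
       * \sum_(x <- U) w x * diffrep (sumset A B) x.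
Proof.
move=> sU w0; rewrite -sum_energy_fiber //.
have e0 x : 0 <= energy (fiber A x) B.
  by apply: sumr_ge0 => a _; apply: sumr_ge0 => b _; exact: sumrep_ge0.
have := cauchy_schwarz_sum U (fun x => Num.sqrt (energy (fiber A x) B))
  (fun x => Num.sqrt (w x * diffrep (sumset A B) x)).
under [X in _ <= X * _]eq_bigr do rewrite sqr_sqrtr //.
under [X in _ <= _ * X]eq_bigr do rewrite sqr_sqrtr ?mulr_ge0 ?diffrep_ge0 //.
apply: le_trans; rewrite -exprMn ler_sqr ?nnegrE; last 2 first.
- by rewrite mulr_ge0 // sumr_ge0 // => x _; rewrite mulr_ge0 ?diffrep_ge0.
- by apply: sumr_ge0 => x _; rewrite mulr_ge0.
rewrite mulr_suml; apply: ler_sum => x _.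
rewrite sqrtrM // [leRHS]mulrCA [leRHS]mulrC mulrAC.
rewrite ler_wpM2r // -sqrtrM ?e0 //.
rewrite -[leLHS]ger0_norm ?mulr_ge0 ?diffrep_ge0 // -sqrtr_sqr ler_wsqrtr //.
by rewrite [energy _ _ * _]mulrC card_fiber_le.
Qed.

End Representations.

(** * Energies and popular differences of sets of Szemeredi-Trotter type *)

Section SzTEstimates.
Variables (R : realType) (K alpha : R).
Hypotheses (K0 : 0 < K) (alpha1 : 1 <= alpha).
Implicit Types (A B S U P : {fset R}) (c : R).

Definition szt_const c B : R := K * c * #|` B|%:R `^ alpha.

(** The Szemeredi-Trotter hypothesis in a form valid at every [t > 0] and over any finite [U], ready
    for reflection and for the weak-cube estimates. *)
Definition szt_bound c A :=
  forall B U, weak_cube U (sumrep A B) (szt_const c B).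

Lemma sum_indicator U (p : pred R) (F : R -> R) :
  \sum_(x <- U) F x * (p x)%:R = \sum_(x <- [fset x in U | p x]%fset) F x.
Proof.
rewrite -big_fset_condE [RHS]big_mkcond /=; apply: eq_bigr => x _.
by case: (p x); rewrite ?mulr1 ?mulr0.
Qed.

Lemma card_indicator U (p : pred R) :
  \sum_(x <- U) (p x)%:R = #|` [fset x in U | p x]%fset|%:R :> R.
Proof.
by rewrite natr_card -(sum_indicator _ _ (fun=> 1)); apply: eq_bigr => x _;
  rewrite mul1r.
Qed.

Lemma szt_const_ge0 c B : 0 < c -> 0 <= szt_const c B.
Proof. by move=> c0; rewrite /szt_const !mulr_ge0 ?powR_ge0 // ltW. Qed.

(** Outside the sumset the count vanishes. For [t < 1], integrality puts the level set inside that
    of height 1, while [t ^- 3] is at least 1. *)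
Lemma SzT_type_bound c A : SzT_type K alpha c A -> szt_bound c A.
Proof.
move=> [_ c0 hA] B U.
have h1 t : 1 <= t ->
    \sum_(x <- U) (t <= sumrep A B x)%R%:R <= szt_const c B * t ^- 3.
  move=> t1; have := hA B t t1; rewrite !mulrA => /(le_trans _); apply.
  rewrite card_indicator ler_nat; apply: fsubset_leq_card.
  apply/fsubsetP => x; rewrite !inE /= => /andP[_ tx].
  rewrite setconvE tx andbT; apply/negPn/negP => /sumrep_notin x0.
  by move: (lt_le_trans ltr01 (le_trans t1 tx)); rewrite x0 ltxx.
move=> t t0; have [/h1//|t1] := leP 1 t.
apply: (@le_trans _ _ (szt_const c B)).
  have := h1 1 (lexx _); rewrite expr1n invr1 mulr1; apply: le_trans.
  apply: ler_sum => x _; rewrite ler_nat.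
  have [e|e] := sumrep_nat A B x; last by rewrite e; case: (_ <= _).
  by rewrite e leNgt t0.
rewrite ler_peMr ?szt_const_ge0 // -exprVn exprn_ege1 //.
by rewrite invf_ge1 // ltW.
Qed.

Lemma szt_bound_oppset c A : szt_bound c A -> szt_bound c (oppset A).
Proof.
move=> hA B U t t0; under eq_bigr do rewrite sumrep_oppset.
have := hA (oppset B) (oppset U) t t0.
by rewrite sum_oppset /szt_const card_oppset.
Qed.

Lemma szt_bound_diffrep c A U : szt_bound c A ->
  weak_cube U (diffrep A) (szt_const c A).
Proof.
move=> hA t t0; under eq_bigr do rewrite diffrepE.
by have := hA (oppset A) U t t0; rewrite /szt_const card_oppset.
Qed.

Lemma energy_ge0 A B : 0 <= energy A B.
Proof. by apply: sumr_ge0 => a _; apply: sumr_ge0 => b _; exact: sumrep_ge0. Qed.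

(** Cauchy-Schwarz for r_A and r_B over a set containing both difference sets. *)
Lemma energy_cauchy A B : energy A B ^+ 2 <= energy A A * energy B B.
Proof.
pose U := (diffset A A `|` diffset B B)%fset.
have sA : {subset diffset A A <= U} by move=> x; rewrite inE => ->.
have sB : {subset diffset B B <= U} by move=> x; rewrite inE orbC => ->.
rewrite -(energy_diffrep B sA) -(energy_diffrep A sA) -(energy_diffrep B sB).
exact: cauchy_schwarz_sum.
Qed.

Section OneSet.
Variables (c : R) (A : {fset R}).
Hypotheses (c0 : 0 < c) (hA : szt_bound c A).

Lemma energy_self_le U : {subset diffset A A <= U} ->
  energy A A ^+ 3 <= 64 * szt_const c A
    * (\sum_(x <- U) diffrep A x * Num.sqrt (diffrep A x)) ^+ 2.
Proof.
move=> sU; rewrite -(energy_diffrep _ sU).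
apply: (@weak_cube_sum32 _ _ _ _ _ #|` A|%:R).
- exact: szt_const_ge0.
- exact: szt_bound_diffrep.
- by move=> x; rewrite diffrepE sumrep_le.
- by move=> x; exact: diffrep_ge0.
Qed.

Lemma energy_le S :
  energy A S ^+ 2 <= 32 * szt_const c S * (#|` A|%:R * #|` S|%:R).
Proof.
have sS : {subset sumset A S <= sumset A S} by [].
rewrite -(energy_sumrep sS) -(sum_sumrep1 sS).
apply: (@weak_cube_sum2 _ _ _ _ _ #|` A|%:R) => // [|x|x].
- exact: szt_const_ge0.
- exact: sumrep_le.
- exact: sumrep_ge0.
Qed.

Lemma sum_diffrep_cube (U : {fset R}) (n : R) :
  2 <= n -> 0 < #|` A|%:R :> R -> #|` A|%:R <= n ->
  \sum_(x <- U) diffrep A x ^+ 3 <= 16 * szt_const c A * log2 n.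
Proof.
(* The successor makes [2 ^+ J] strictly exceed all values of [diffrep A]; as [2 <= n] gives
   [1 <= log2 n], it costs only a factor 2. *)
move=> n2 a0 an; pose J := (trunc_log 2 #|` A|).+1.
have l2 : 0 < ln 2 :> R by rewrite ln_gt0 // ltr1n.
apply: (@le_trans _ _ (8 * szt_const c A * J%:R)).
  apply: weak_cube_sum3 => [|x|x].
  - exact: szt_bound_diffrep.
  - by rewrite diffrepE; exact: sumrep_nat.
  - rewrite diffrepE; apply: le_lt_trans (sumrep_le _ _ _) _.
    by rewrite -natrX ltr_nat trunc_log_ltn.
have -> : 16 * szt_const c A * log2 n = 8 * szt_const c A * (2 * log2 n) by ring.
apply: ler_wpM2l; first by rewrite mulr_ge0 // szt_const_ge0.
have L1 : 1 <= log2 n by rewrite /log2 ler_pdivlMr // mul1r ler_ln ?posrE //; lra.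
suff h : (trunc_log 2 #|` A|)%:R <= log2 n.
  by rewrite -[J]addn1 natrD; lra.
rewrite /log2 ler_pdivlMr // mulr_natl -lnXn // ler_ln ?posrE ?exprn_gt0 //; last lra.
by apply: le_trans an; rewrite -natrX ler_nat trunc_logP // -(ltr_nat R).
Qed.

Lemma popular_diffrep_le P :
  (\sum_(x <- P) diffrep A x) ^+ 3 <= 32 * #|` A|%:R ^+ 2 * szt_const c P.
Proof.
rewrite sum_popular_diffrep.
apply: (@weak_cube_sum1 _ _ _ _ _ #|` A|%:R) => // [|x|x].
- exact: szt_const_ge0.
- exact: sumrep_le.
- exact: sumrep_ge0.
Qed.

(** Hoelder with [f] the square root of [diffrep A] and [g = 1]; the total mass of [diffrep A] is
    |A|^2. *)
Lemma diffrep_sum_cube U : {subset diffset A A <= U} ->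
  #|` A|%:R ^+ 6 <= #|` U|%:R
    * (\sum_(x <- U) diffrep A x * Num.sqrt (diffrep A x)) ^+ 2.
Proof.
move=> sU.
have := holder_sum U (fun x => sqrtr_ge0 (diffrep A x)) (fun=> ler01).
under eq_bigr do rewrite mulr1 sqr_sqrtr ?diffrep_ge0 //.
under [X in X ^+ 2 * _]eq_bigr do
  rewrite exprSr sqr_sqrtr ?diffrep_ge0 //.
under [X in _ * X]eq_bigr do rewrite expr1n.
have -> : \sum_(x <- U) diffrep A x = #|` A|%:R ^+ 2.
  under eq_bigr do rewrite diffrepE.
  by rewrite sum_sumrep1 -?diffset_sumset // card_oppset.
by rewrite -natr_card -exprM mulrC.
Qed.

End OneSet.

Section TwoSets.
Variables (c c' : R) (A B : {fset R}).
Hypotheses (c0 : 0 < c) (c'0 : 0 < c') (hA : szt_bound c A) (hB : szt_bound c' B).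

Lemma sum_diffrep_mixed (U : {fset R}) (n : R) : 2 <= n ->
  0 < #|` A|%:R :> R -> #|` A|%:R <= n -> 0 < #|` B|%:R :> R -> #|` B|%:R <= n ->
  (\sum_(x <- U) diffrep A x ^+ 2 * diffrep B x) ^+ 3
    <= (16 * log2 n) ^+ 3 * (szt_const c A ^+ 2 * szt_const c' B).
Proof.
move=> n2 a0 an b0 bn.
apply: le_trans (holder_sum U (diffrep_ge0 A) (diffrep_ge0 B)) _.
have -> : (16 * log2 n) ^+ 3 * (szt_const c A ^+ 2 * szt_const c' B) =
   (16 * szt_const c A * log2 n) ^+ 2 * (16 * szt_const c' B * log2 n) by ring.
have p X : 0 <= \sum_(x <- U) diffrep X x ^+ 3.
  by apply: sumr_ge0 => x _; rewrite exprn_ge0 ?diffrep_ge0.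
have hA3 := sum_diffrep_cube c0 hA U n2 a0 an.
apply: ler_pM; rewrite ?exprn_ge0 //.
- by apply: lerXn2r; rewrite ?nnegrE ?p //; exact: le_trans (p A) hA3.
- exact: sum_diffrep_cube.
Qed.

(** The bound of [popular_diffrep_le] with |P| replaced by [szt_const c' B], the power of [u] being
    split off; the cube root undoes the cube there. *)
Definition level_const : R :=
  (32 * #|` A|%:R ^+ 2 * (K * c * szt_const c' B `^ alpha)) `^ 3^-1.

Lemma level_const_ge0 : 0 <= level_const.
Proof. exact: powR_ge0. Qed.

Lemma level_const_cube : level_const ^+ 3 =
  32 * #|` A|%:R ^+ 2 * (K * c * szt_const c' B `^ alpha).
Proof.
rewrite -powR_mulrn ?level_const_ge0 // /level_const -powRrM mulVf // powRr1 //.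
by rewrite !mulr_ge0 ?powR_ge0 ?exprn_ge0 // ltW.
Qed.

(** The hypothesis on [B] bounds the number of x with r_B(x) >= u by a multiple of [u ^- 3]; that on
    [A] then bounds the mass of r_A on them. *)
Lemma level_sum_le U (u : R) : 0 < u ->
  \sum_(x <- U) diffrep A x * (u <= diffrep B x)%R%:R
    <= level_const * u `^ (- alpha).
Proof.
move=> u0; rewrite (sum_indicator U (fun x => u <= diffrep B x)%R).
set P := [fset x in U | _]%fset.
have H0 := level_const_ge0.
rewrite -(@ler_pXn2r _ 3) ?nnegrE ?mulr_ge0 ?powR_ge0 //; last first.
  by apply: sumr_ge0 => x _; exact: diffrep_ge0.
apply: le_trans (popular_diffrep_le c0 hA P) _.
have M0 := szt_const_ge0 B c'0.
have -> : (level_const * u `^ (- alpha)) ^+ 3 =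
    32 * #|` A|%:R ^+ 2 * (K * c * (szt_const c' B * u ^- 3) `^ alpha).
  rewrite exprMn level_const_cube; move: (szt_const _ _) M0 => M M0.
  rewrite -!mulrA; congr (_ * (_ * (_ * (_ * _)))).
  rewrite powRM // ?invr_ge0 ?exprn_ge0 ?(ltW u0) //.
  rewrite -(powR_invn 3 (ltW u0)) -(powR_mulrn 3 (powR_ge0 _ _)) -!powRrM.
  by have -> : - alpha * 3 = - 3 * alpha by ring.
apply: ler_wpM2l; first by rewrite mulr_ge0 ?exprn_ge0.
apply: ler_wpM2l; first by rewrite mulr_ge0 // ltW.
apply: ge0_ler_powR; rewrite ?nnegrE ?(mulr_ge0 M0) ?invr_ge0 ?exprn_ge0 ?(ltW u0) //.
  by rewrite (le_trans _ alpha1).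
have := szt_bound_diffrep U hB u0.
by rewrite (card_indicator U (fun x => u <= diffrep B x)%R).
Qed.

(** A layer at height u contributes at most a multiple of u^(1 - alpha), so the dyadic series is
    geometric with ratio 2^(1 - alpha) < 1. *)
Lemma tail_sum_le U (t : R) : 1 < alpha -> 0 < t ->
  \sum_(x <- U) (t <= diffrep B x)%R%:R * (diffrep A x * diffrep B x)
    <= 2 * level_const * t `^ (1 - alpha) * (1 - 2 `^ (1 - alpha))^-1.
Proof.
move=> al1 t0; have [J NJ] := dyadic_bound #|` B|%:R t0.
have bJ x : diffrep B x < 2 ^+ J * t.
  by rewrite diffrepE; exact: le_lt_trans (sumrep_le _ _ _) NJ.
have := dyadic_sum 1 U t0 (diffrep_ge0 A) bJ.
under eq_bigr do rewrite expr1.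
move=> /le_trans; apply.
apply: (@le_trans _ _ (\sum_(j < J)
    2 * level_const * t `^ (1 - alpha) * (2 `^ (1 - alpha)) ^+ j)).
  apply: ler_sum => j _; have u0 : 0 < 2 ^+ j * t by rewrite mulr_gt0 ?exprn_gt0.
  have h := ler_wpM2l (ltW u0) (level_sum_le U u0).
  have key : 2 ^+ j * t * (level_const * (2 ^+ j * t) `^ (- alpha)) =
      level_const * (t `^ (1 - alpha) * (2 `^ (1 - alpha)) ^+ j).
    rewrite mulrCA -[X in X * _ `^ _]powRr1 ?(ltW u0) //.
    rewrite -powRD ?(gt_eqF u0) ?implybT // powRM ?exprn_ge0 ?(ltW t0) //.
    rewrite -!powR_mulrn ?powR_ge0 // -!powRrM [j%:R * _]mulrC.
    by rewrite [2 `^ _ * _]mulrC.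
  rewrite key in h.
  have -> : (2 ^+ j.+1 * t) ^+ 1 = 2 * (2 ^+ j * t) by rewrite expr1 exprS mulrA.
  have -> : 2 * level_const * t `^ (1 - alpha) * 2 `^ (1 - alpha) ^+ j =
    2 * (level_const * (t `^ (1 - alpha) * 2 `^ (1 - alpha) ^+ j)) by ring.
  by rewrite -[leLHS]mulrA; apply: ler_wpM2l.
rewrite -mulr_sumr; apply: ler_wpM2l.
  by rewrite !mulr_ge0 ?powR_ge0 // level_const_ge0.
apply: geometric_sum_le; first exact: powR_ge0.
rewrite -[ltRHS](@powRr0 _ 2) /powR pnatr_eq0 /= ltr_expR mul0r.
by rewrite pmulr_llt0 ?ln_gt0 ?ltr1n // subr_lt0.
Qed.

Lemma energy_threshold U (t : R) : {subset diffset A A <= U} ->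
  1 < alpha -> 0 < t ->
  energy A B <= 2 * level_const * t `^ (1 - alpha) * (1 - 2 `^ (1 - alpha))^-1
    + Num.sqrt t * \sum_(x <- U) diffrep A x * Num.sqrt (diffrep B x).
Proof.
move=> sU al1 t0; rewrite -(energy_diffrep B sU).
apply: le_trans (lerD (tail_sum_le U al1 t0) (lexx _)).
rewrite mulr_sumr -big_split /=; apply: ler_sum => x _.
have dA := diffrep_ge0 A x; have dB := diffrep_ge0 B x.
case: (leP t (diffrep B x)) => h; first by rewrite mul1r lerDl !mulr_ge0.
rewrite mul0r add0r mulrCA ler_wpM2l // -{1}[diffrep B x]sqr_sqrtr // expr2.
by rewrite ler_wpM2r // ler_sqrt // ltW.
Qed.

End TwoSets.
End SzTEstimates.

(** * Logarithms, which turn products of powers into linear inequalities *)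

Section Logarithms.
Variable R : realType.
Implicit Types x y : R.

Lemma ln_mul x y : 0 < x -> 0 < y -> ln (x * y) = ln x + ln y.
Proof. by move=> x0 y0; rewrite lnM ?posrE. Qed.

Lemma ln_exp x n : 0 < x -> ln (x ^+ n) = n%:R * ln x.
Proof. by move=> x0; rewrite lnXn // mulr_natl. Qed.

Lemma ln_le x y : 0 < x -> x <= y -> ln x <= ln y.
Proof. by move=> x0 xy; rewrite ler_ln ?posrE // (lt_le_trans x0). Qed.

Lemma le_of_ln x y : 0 < x -> 0 < y -> ln x <= ln y -> x <= y.
Proof. by move=> x0 y0; rewrite ler_ln ?posrE. Qed.

(** The logarithms of the three hypotheses are linear in [ln T] and [ln W], which are eliminated;
    13/2 is 4 from the 16 plus 5/2 from the root of 32. *)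
Lemma ln_katz_koester (Q b T W L M M' N : R) :
  0 < Q -> 0 < b -> 0 < L -> 0 < M -> 0 < M' -> 0 < N -> 0 <= T -> 0 <= W ->
  Q ^+ 2 * b ^+ 2 <= T * W -> T ^+ 3 <= (16 * L) ^+ 3 * (M ^+ 2 * M') ->
  W ^+ 2 <= 32 * N ->
  2 * ln Q + 2 * ln b
    <= 13 / 2 * ln 2 + ln L + (2 * ln M + ln M') / 3 + ln N / 2.
Proof.
move=> Q0 b0 L0 M0 M'0 N0 T0 W0 hQ hT hW.
have p : 0 < Q ^+ 2 * b ^+ 2 by rewrite mulr_gt0 ?exprn_gt0.
have TW : 0 < T * W := lt_le_trans p hQ.
have Tp : 0 < T.
  by rewrite lt0r T0 andbT; apply: contraTneq TW => ->; rewrite mul0r ltxx.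
have Wp : 0 < W.
  by rewrite lt0r W0 andbT; apply: contraTneq TW => ->; rewrite mulr0 ltxx.
have := ln_le p hQ; have := ln_le (exprn_gt0 3 Tp) hT.
have := ln_le (exprn_gt0 2 Wp) hW.
have e16 : (16 : R) = 2 ^+ 4 by ring.
have e32 : (32 : R) = 2 ^+ 5 by ring.
have p16 : 0 < 16 * L by rewrite mulr_gt0.
have p32 : 0 < 32 * N by rewrite mulr_gt0.
have pM : 0 < M ^+ 2 * M' by rewrite mulr_gt0 ?exprn_gt0.
rewrite (ln_mul Tp Wp) (ln_mul (exprn_gt0 2 Q0) (exprn_gt0 2 b0)).
rewrite (ln_mul (exprn_gt0 3 p16) pM) (ln_mul (exprn_gt0 2 M0) M'0).
rewrite (ln_mul _ N0) // !ln_exp // (ln_mul _ L0) // e16 e32 !ln_exp //.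
lra.
Qed.

End Logarithms.

(** * The lower bounds in logarithmic form *)

Section PairEstimates.
Variables (R : realType) (K alpha c c' : R) (A B : {fset R}).
Hypotheses (K0 : 0 < K) (alpha1 : 1 <= alpha) (c0 : 0 < c) (c'0 : 0 < c').
Hypotheses (hA : szt_bound K alpha c A) (hB : szt_bound K alpha c' B).
Local Notation a := (#|` A|%:R : R).
Local Notation b := (#|` B|%:R : R).
Local Notation S := (sumset A B).
Local Notation s := (#|` S|%:R : R).
Local Notation L := (log2 (a * b)).
Hypothesis ab2 : 2 <= a * b.

(** Large enough for both bounds free of alpha - 1, whose coefficients of [ln 2] and [ln K] are
    13/2, 3/2 and 25/2, 5/2; the absolute value allows for [K < 1]. *)
Definition implied_const : R := 13 * ln 2 + 3 * `|ln K|.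

(** The exact error in [ln_sumset_ge2]: the multiple of [alpha - 1] comes from Katz-Koester and the
    halving, the rest from the factor [4 * H / eta] of the cut-off. *)
Definition implied_const2 : R :=
  (alpha - 1) * (17 / 2 * ln 2 + 3 / 2 * ln K) + 2 * ln 2
  + (5 * ln 2 + (1 + alpha) * ln K) / 3 - ln (1 - 2 `^ (1 - alpha)).

Lemma card_gt0_l : 0 < a.
Proof.
by rewrite lt0r ler0n andbT; apply: contraTneq ab2 => ->; rewrite mul0r -ltNge.
Qed.

Lemma card_gt0_r : 0 < b.
Proof.
by rewrite lt0r ler0n andbT; apply: contraTneq ab2 => ->; rewrite mulr0 -ltNge.
Qed.

Let a0 := card_gt0_l.
Let b0 := card_gt0_r.

Lemma card_le_prod_l : a <= a * b.
Proof. by rewrite ler_peMr // ler1n -(ltr0n R). Qed.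

Lemma card_le_prod_r : b <= a * b.
Proof. by rewrite ler_peMl // ler1n -(ltr0n R). Qed.

Lemma log2_card_gt0 : 0 < L.
Proof. by rewrite divr_gt0 ?ln_gt0 ?ltr1n // (lt_le_trans _ ab2) // ltr1n. Qed.

Lemma card_sumset_gt0 : 0 < s.
Proof.
rewrite lt0r ler0n andbT; apply: contraTneq (energy_ge A B) => ->.
by rewrite mul0r -ltNge exprn_gt0 // mulr_gt0.
Qed.

Let L0 := log2_card_gt0.
Let s0 := card_sumset_gt0.

Lemma szt_const_gt0 d (X : {fset R}) : 0 < d -> 0 < #|` X|%:R :> R ->
  0 < szt_const K alpha d X.
Proof. by move=> d0 X0; rewrite /szt_const !mulr_gt0 ?powR_gt0. Qed.

Lemma ln_szt_const d (X : {fset R}) : 0 < d -> 0 < #|` X|%:R :> R ->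
  ln (szt_const K alpha d X) = ln K + ln d + alpha * ln #|` X|%:R.
Proof.
by move=> d0 X0; rewrite /szt_const !ln_mul ?ln_powR ?mulr_gt0 ?powR_gt0.
Qed.

(** Katz-Koester with weight r_D, to be used for [D] equal to [A] or [B]; the hypothesis on [D]
    bounds its energy with the sumset. *)
Lemma ln_weighted_sum_le d (D U : {fset R}) : 0 < d -> szt_bound K alpha d D ->
  {subset diffset A A <= U} -> {subset diffset D D <= U} ->
  0 < #|` D|%:R :> R ->
  let Q := \sum_(x <- U) diffrep A x * Num.sqrt (diffrep D x) in
  0 < Q ->
  2 * ln Q + 2 * ln b <= 13 / 2 * ln 2 + ln L
    + (2 * (ln K + ln c + alpha * ln a) + (ln K + ln c' + alpha * ln b)) / 3
    + (ln K + ln d + alpha * ln s + (ln #|` D|%:R + ln s)) / 2.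
Proof.
move=> d0 hD sA sD D0 Q Q0.
have MS := szt_const_gt0 d0 s0.
rewrite -!ln_szt_const // -(ln_mul D0 s0) -(ln_mul MS (mulr_gt0 D0 s0)).
apply: (ln_katz_koester Q0 b0 L0 _ _ _ _ _
   (katz_koester B sA (diffrep_ge0 D))).
- exact: szt_const_gt0.
- exact: szt_const_gt0.
- exact: mulr_gt0 MS (mulr_gt0 D0 s0).
- by apply: sumr_ge0 => x _; rewrite mulr_ge0 ?exprn_ge0 ?diffrep_ge0.
- by apply: sumr_ge0 => x _; rewrite mulr_ge0 ?diffrep_ge0.
- exact: (sum_diffrep_mixed K0 c0 c'0 hA hB U ab2 a0 card_le_prod_l b0 card_le_prod_r).
- by rewrite (energy_diffrep _ sD) mulrA; exact: energy_le.
Qed.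

Lemma ln_implied_const (x y : R) : 0 <= x -> x <= 13 -> 0 <= y -> y <= 3 ->
  x * ln 2 + y * ln K <= implied_const.
Proof.
move=> x0 x13 y0 y3; have l2 : 0 <= ln 2 :> R by rewrite ln_ge0 // ler1n.
apply: lerD; first by rewrite ler_wpM2r.
by apply: le_trans (ler_wpM2l y0 (ler_norm _)) _; rewrite ler_wpM2r.
Qed.

(** With weight r_A, [Q] is bounded below by [diffrep_sum_cube] and above by Katz-Koester. *)
Lemma ln_sumset_diffset_ge :
  (33 - 4 * alpha) / 6 * ln a + (6 - alpha) / 3 * ln b - 7 / 6 * ln c
    - 1 / 3 * ln c' - ln L - implied_const
  <= (alpha + 1) / 2 * ln s + ln #|` diffset A A|%:R.
Proof.
have sA : {subset diffset A A <= diffset A A} by [].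
have h := diffrep_sum_cube sA.
have h2 := ln_weighted_sum_le c0 hA sA sA a0; move: h h2 => /=.
set Q := \sum_(x <- _) _ => h h2.
have Q00 : 0 <= Q by apply: sumr_ge0 => x _; rewrite mulr_ge0 ?diffrep_ge0.
have Q0 : 0 < Q.
  rewrite lt0r Q00 andbT; apply: contraTneq h => ->.
  by rewrite expr0n mulr0 -ltNge exprn_gt0.
have D0 : 0 < #|` diffset A A|%:R :> R.
  rewrite lt0r ler0n andbT; apply: contraTneq h => ->.
  by rewrite mul0r -ltNge exprn_gt0.
have := ln_le (exprn_gt0 6 a0) h; rewrite ln_mul ?exprn_gt0 // !ln_exp //.
have := h2 Q0; have := @ln_implied_const (13 / 2) (3 / 2).
move=> /(_ ltac:(lra) ltac:(lra) ltac:(lra) ltac:(lra)).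
lra.
Qed.

(** A large energy of [A] forces a large [Q] through [energy_self_le], against the Katz-Koester
    upper bound with weight r_A. *)
Lemma ln_sumset_ge_of_energy : (a * b) ^+ 2 <= s * energy A A ->
  (24 - alpha) / 3 * ln b + (33 - 10 * alpha) / 6 * ln a - 13 / 6 * ln c
    - 1 / 3 * ln c' - ln L - implied_const <= (7 + alpha) / 2 * ln s.
Proof.
move=> hE; have sA : {subset diffset A A <= diffset A A} by [].
have h := energy_self_le K0 c0 hA sA.
have h2 := ln_weighted_sum_le c0 hA sA sA a0; move: h h2 => /=.
set Q := \sum_(x <- _) _ => h h2.
have Q00 : 0 <= Q by apply: sumr_ge0 => x _; rewrite mulr_ge0 ?diffrep_ge0.
have ab0 : 0 < (a * b) ^+ 2 by rewrite exprn_gt0 // mulr_gt0.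
have E0 : 0 < energy A A.
  rewrite lt0r energy_ge0 andbT; apply: contraTneq hE => ->.
  by rewrite mulr0 -ltNge.
have Q0 : 0 < Q.
  rewrite lt0r Q00 andbT; apply: contraTneq h => ->.
  by rewrite expr0n mulr0 -ltNge exprn_gt0.
have M0 := szt_const_gt0 c0 a0.
have := ln_le ab0 hE; have := ln_le (exprn_gt0 3 E0) h.
have e64 : (64 : R) = 2 ^+ 6 by ring.
have p64 : 0 < 64 * szt_const K alpha c A by exact: mulr_gt0.
rewrite (ln_mul p64 (exprn_gt0 2 Q0)) (ln_mul _ M0) // ln_szt_const //.
rewrite (ln_mul s0 E0) !ln_exp ?(mulr_gt0 a0 b0) // (ln_mul a0 b0) e64 ln_exp //.
have := h2 Q0; have := @ln_implied_const (25 / 2) (5 / 2).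
move=> /(_ ltac:(lra) ltac:(lra) ltac:(lra) ltac:(lra)).
lra.
Qed.

Lemma ln_sumset_ge2 : 1 < alpha ->
  (14 * alpha - 2 * alpha ^+ 2 - 8) / 3 * ln a
    + (35 * alpha - 4 * alpha ^+ 2 - 21) / 6 * ln b
    - (2 * alpha - 1) / 3 * ln c - (7 * alpha - 5) / 6 * ln c'
    - (alpha - 1) * ln L - implied_const2
  <= (alpha ^+ 2 + 4 * alpha - 3) / 2 * ln s.
Proof.
move=> al1; pose U := (diffset A A `|` diffset B B)%fset.
have sA : {subset diffset A A <= U} by move=> x; rewrite inE => ->.
have sB : {subset diffset B B <= U} by move=> x; rewrite inE orbC => ->.
pose H := level_const K alpha c c' A B.
pose eta : R := 1 - 2 `^ (1 - alpha).
have eta0 : 0 < eta.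
  rewrite subr_gt0 -[ltRHS](@powRr0 _ 2) /powR pnatr_eq0 /= ltr_expR mul0r.
  by rewrite pmulr_llt0 ?ln_gt0 ?ltr1n // subr_lt0.
have M0 := szt_const_gt0 c0 a0; have M'0 := szt_const_gt0 c'0 b0.
have H0 : 0 < H.
  by rewrite powR_gt0 // !mulr_gt0 // ?exprn_gt0 // powR_gt0.
have be0 : 0 < alpha - 1 by rewrite subr_gt0.
(* Chosen so that at the cut-off [t], where t^(1 - alpha) is [v^-1], the tail bound times [s] is
   exactly [(a * b) ^+ 2 / 2]. *)
pose v := 4 * H * s / (eta * (a * b) ^+ 2).
have v0 : 0 < v by rewrite divr_gt0 ?mulr_gt0 ?exprn_gt0 ?mulr_gt0.
pose t := v `^ (alpha - 1)^-1.
have t0 : 0 < t by rewrite powR_gt0.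
have tv : t `^ (1 - alpha) = v^-1.
  rewrite -powRrM -(powR_inv1 (ltW v0)); congr (_ `^ _).
  by rewrite -[1 - alpha]opprB mulrN mulVf ?gt_eqF.
have := energy_threshold K0 alpha1 c0 c'0 hA hB sA al1 t0.
have h2 := ln_weighted_sum_le c'0 hB sA sB b0; move: h2 => /=.
set Q := \sum_(x <- _) _ => h2 hE.
have Q00 : 0 <= Q by apply: sumr_ge0 => x _; rewrite mulr_ge0 ?diffrep_ge0.
(* Half of the lower bound for [s * energy A B] is absorbed by the tail; the other half falls to
   [Q]. *)
have hQ : (a * b) ^+ 2 <= 2 * s * (Num.sqrt t * Q).
  have h := energy_ge A B.
  have := ler_wpM2l (ltW s0) hE; rewrite tv -/H -/eta.
  have -> : s * (2 * H * v^-1 * eta^-1 + Num.sqrt t * Q) =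
     (a * b) ^+ 2 / 2 + s * (Num.sqrt t * Q).
    by rewrite /v; field; rewrite !gt_eqF.
  lra.
have ab0 : 0 < (a * b) ^+ 2 by rewrite exprn_gt0 // mulr_gt0.
have Q0 : 0 < Q.
  rewrite lt0r Q00 andbT; apply: contraTneq hQ => ->.
  by rewrite !mulr0 -ltNge.
have rt0 : 0 < Num.sqrt t by rewrite sqrtr_gt0.
have lt2 : ln (Num.sqrt t) = 2^-1 * ln t by rewrite -powR12_sqrt ?ln_powR // ltW.
have lt1 : (alpha - 1) * ln t = ln v.
  by rewrite ln_powR mulrA mulfV ?mul1r ?gt_eqF.
have lv : ln v = 2 * ln 2 + ln H + ln s - (ln eta + 2 * (ln a + ln b)).
  have e4 : (4 : R) = 2 ^+ 2 by ring.
  rewrite /v lnM ?posrE ?invr_gt0 ?mulr_gt0 // lnV ?posrE ?mulr_gt0 //.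
  rewrite (ln_mul eta0 ab0) ln_exp ?mulr_gt0 // (ln_mul a0 b0).
  by rewrite (ln_mul _ s0) ?mulr_gt0 // (ln_mul _ H0) // e4 ln_exp.
have lH : 3 * ln H = 5 * ln 2 + 2 * ln a
    + (ln K + ln c + alpha * (ln K + ln c' + alpha * ln b)).
  rewrite ln_powR mulrA mulfV // mul1r -ln_szt_const //.
  have e32 : (32 : R) = 2 ^+ 5 by ring.
  have Kc0 : 0 < K * c by rewrite mulr_gt0.
  have Ma0 := powR_gt0 alpha M'0; have a20 := exprn_gt0 2 a0.
  rewrite (ln_mul _ (mulr_gt0 Kc0 Ma0)) ?mulr_gt0 // (ln_mul _ a20) // e32.
  by rewrite !ln_exp // (ln_mul Kc0 Ma0) (ln_mul K0 c0) ln_powR.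
have := ln_le ab0 hQ.
rewrite ln_exp ?mulr_gt0 // (ln_mul a0 b0) (ln_mul _ (mulr_gt0 rt0 Q0)) ?mulr_gt0 //.
rewrite (ln_mul _ s0) // (ln_mul rt0 Q0) lt2 => hl.
have := h2 Q0 => {}h2.
have h3 : 4 * (ln a + ln b) + 2 * ln b - ln t <=
  2 * ln 2 + 2 * ln s + (13 / 2 * ln 2 + ln L
    + (2 * (ln K + ln c + alpha * ln a) + (ln K + ln c' + alpha * ln b)) / 3
    + (ln K + ln c' + alpha * ln s + (ln b + ln s)) / 2) by lra.
(* Multiplying by [alpha - 1] turns [ln t] into [ln v], which is linear in the remaining
   logarithms. *)
have := ler_wpM2l (ltW be0) h3; rewrite mulrBr lt1 lv /implied_const2 -/eta.
have -> : ln H = (5 * ln 2 + 2 * ln a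
    + (ln K + ln c + alpha * (ln K + ln c' + alpha * ln b))) / 3 by rewrite -lH; field.
nra.
Qed.

End PairEstimates.

(** * From logarithms back to powers *)

Lemma exponent_den_gt0 (R : realType) (x : R) : 1 <= x -> 0 < 7 + x.
Proof. by move=> x1; lra. Qed.

Lemma exponent_den_le1 (R : realType) (x : R) : 1 <= x -> 2 / (7 + x) <= 1.
Proof. by move=> x1; rewrite ler_pdivrMr ?exponent_den_gt0 //; lra. Qed.

Lemma exponent_quad_gt0 (R : realType) (x : R) :
  1 <= x -> 0 < x ^+ 2 + 4 * x - 3.
Proof.
move=> x1; have : 0 <= (x - 1) * (x + 5) by rewrite mulr_ge0; lra.
lra.
Qed.

Section PowerForm.
Variables (R : realType) (K : R).
Hypothesis K0 : 0 < K.

(** The second summand makes the same constant serve the specialization of [ln_sumset_ge2] to alpha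
    = 2, whose error depends on [K] alone. *)
Definition lower_const : R :=
  expR (- (implied_const K + `|implied_const2 K 2|)).

(** With [t] standing for the inverse of [alpha - 1], alpha is recovered from [t], so the constant
    depends on nothing else besides [K]. *)
Definition lower_const2 (t : R) : R :=
  let alpha := 1 + t^-1 in
  expR (- (2 / (alpha ^+ 2 + 4 * alpha - 3) * implied_const2 K alpha)).

Lemma implied_const_ge0 : 0 <= implied_const K.
Proof. by rewrite addr_ge0 ?mulr_ge0 ?ln_ge0 ?ler1n. Qed.

Lemma ln_prod4 (x y z w v l e1 e2 e3 e4 e5 : R) :
  0 < x -> 0 < y -> 0 < z -> 0 < w -> 0 < l ->
  0 < expR v * (x `^ e1 * y `^ e2 * z `^ e3 * w `^ e4 * l `^ e5) /\
  ln (expR v * (x `^ e1 * y `^ e2 * z `^ e3 * w `^ e4 * l `^ e5))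
    = v + (e1 * ln x + e2 * ln y + e3 * ln z + e4 * ln w + e5 * ln l).
Proof.
move=> x0 y0 z0 w0 l0; have p := powR_gt0.
have v0 := expR_gt0 v.
have xy : 0 < x `^ e1 * y `^ e2 by rewrite mulr_gt0 ?p.
have xyz : 0 < x `^ e1 * y `^ e2 * z `^ e3 by rewrite mulr_gt0 ?p.
have xyzw : 0 < x `^ e1 * y `^ e2 * z `^ e3 * w `^ e4 by rewrite mulr_gt0 ?p.
have xyzwl : 0 < x `^ e1 * y `^ e2 * z `^ e3 * w `^ e4 * l `^ e5.
  by rewrite mulr_gt0 ?p.
split; first exact: mulr_gt0.
rewrite (ln_mul v0 xyzwl) (ln_mul xyzw) ?p // (ln_mul xyz) ?p // (ln_mul xy) ?p //.
by rewrite ln_mul ?p // !ln_powR expRK.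
Qed.

Lemma le_prod4 (x y z w v l e1 e2 e3 e4 e5 s : R) :
  0 < x -> 0 < y -> 0 < z -> 0 < w -> 0 < l -> 0 < s ->
  v + (e1 * ln x + e2 * ln y + e3 * ln z + e4 * ln w + e5 * ln l) <= ln s ->
  expR v * (x `^ e1 * y `^ e2 * z `^ e3 * w `^ e4 * l `^ e5) <= s.
Proof.
move=> x0 y0 z0 w0 l0 s0.
have [p <-] := ln_prod4 v e1 e2 e3 e4 e5 x0 y0 z0 w0 l0.
exact: le_of_ln.
Qed.

Variables (alpha c c' : R) (A B : {fset R}).
Hypotheses (alpha1 : 1 <= alpha) (c0 : 0 < c) (c'0 : 0 < c').
Hypotheses (hA : szt_bound K alpha c A) (hB : szt_bound K alpha c' B).
Local Notation a := (#|` A|%:R : R).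
Local Notation b := (#|` B|%:R : R).
Local Notation S := (sumset A B).
Local Notation s := (#|` S|%:R : R).
Local Notation L := (log2 (a * b)).
Local Notation q := (alpha ^+ 2 + 4 * alpha - 3).
Hypothesis ab2 : 2 <= a * b.

Let a0 : 0 < a := card_gt0_l ab2.
Let b0 : 0 < b := card_gt0_r ab2.
Let s0 : 0 < s := card_sumset_gt0 ab2.
Let L0 : 0 < L := log2_card_gt0 ab2.

Lemma sumset_ge_of_energy : (a * b) ^+ 2 <= s * energy A A ->
  lower_const * (c' `^ (- (2 / (3 * (7 + alpha))))
    * c `^ (- (13 / (3 * (7 + alpha))))
    * b `^ (2 * (24 - alpha) / (3 * (7 + alpha)))
    * a `^ ((33 - 10 * alpha) / (3 * (7 + alpha)))
    * L `^ (- (2 / (7 + alpha)))) <= s.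
Proof.
move=> hE; have h := ln_sumset_ge_of_energy K0 c0 c'0 hA hB ab2 hE.
apply: le_prod4 => //; have k0 := implied_const_ge0.
have al := exponent_den_gt0 alpha1.
have n0 := normr_ge0 (implied_const2 K 2).
have := ler_wpM2l (ltW (divr_gt0 (ltr0n _ 2) al)) h.
have r1 := exponent_den_le1 alpha1.
have -> : 2 / (7 + alpha) * ((7 + alpha) / 2 * ln s) = ln s.
  by field; rewrite gt_eqF.
apply: le_trans; set k := implied_const K in k0 *.
(* Since 2 / (7 + alpha) is at most 1, rescaling only improves the constant, which therefore stays
   uniform in alpha. *)
have rk : 2 / (7 + alpha) * k <= k by rewrite ler_piMl.
rewrite -subr_ge0; set d := (X in 0 <= X).
suff -> : d = (k - 2 / (7 + alpha) * k) + `|implied_const2 K 2|.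
  by rewrite addr_ge0 // subr_ge0.
by rewrite /d; field; rewrite gt_eqF.
Qed.

Lemma sumset_ge2 : 1 < alpha ->
  lower_const2 (alpha - 1)^-1 * (c `^ (- ((4 * alpha - 2) / (3 * q)))
    * c' `^ (- ((7 * alpha - 5) / (3 * q)))
    * a `^ ((28 * alpha - 4 * alpha ^+ 2 - 16) / (3 * q))
    * b `^ ((35 * alpha - 4 * alpha ^+ 2 - 21) / (3 * q))
    * L `^ (- (2 * (alpha - 1) / q))) <= s.
Proof.
move=> al1; have h := ln_sumset_ge2 K0 alpha1 c0 c'0 hA hB ab2 al1.
rewrite /lower_const2 /= invrK [1 + _]addrC subrK.
apply: le_prod4 => //.
have q0 := exponent_quad_gt0 alpha1.
have := ler_wpM2l (ltW (divr_gt0 (ltr0n _ 2) q0)) h.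
have -> : 2 / q * (q / 2 * ln s) = ln s by field; rewrite gt_eqF.
apply: le_trans; rewrite le_eqVlt; apply/orP; left; apply/eqP.
by field; rewrite gt_eqF.
Qed.

Lemma sumset_ge2_at2 : alpha = 2 ->
  lower_const * (c' `^ (- (1 / 3)) * c `^ (- (2 / 9))
    * b `^ (11 / 9) * a `^ (8 / 9) * L `^ (- (2 / 9))) <= s.
Proof.
move=> al2; have al1 : 1 < alpha by rewrite al2 ltr1n.
have h := ln_sumset_ge2 K0 alpha1 c0 c'0 hA hB ab2 al1.
rewrite al2 in h; apply: le_prod4 => //.
have k0 := implied_const_ge0; have n0 := ler_norm (implied_const2 K 2).
have n1 := normr_ge0 (implied_const2 K 2).
lra.
Qed.

Lemma sumset_diffset_ge :
  lower_const * (a `^ ((33 - 4 * alpha) / 6) * b `^ ((6 - alpha) / 3)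
    * c `^ (- (7 / 6)) * c' `^ (- (1 / 3)) * L^-1)
  <= s `^ ((alpha + 1) / 2) * #|` diffset A A|%:R.
Proof.
have h := ln_sumset_diffset_ge K0 c0 c'0 hA hB ab2.
have D0 : 0 < #|` diffset A A|%:R :> R.
  have /fset0Pn[x xA] : A != fset0.
    by rewrite -cardfs_gt0 -(ltr0n R).
  rewrite ltr0n cardfs_gt0; apply/fset0Pn; exists (x - x).
  exact: mem_diffset.
rewrite -(powR_inv1 (ltW L0)); apply: le_prod4 => //.
  by rewrite mulr_gt0 ?powR_gt0.
rewrite ln_mul ?powR_gt0 // ln_powR.
have n1 := normr_ge0 (implied_const2 K 2).
lra.
Qed.

End PowerForm.

(** * The degenerate case and the assembly of the bounds *)

Lemma log2_lt2 (R : realType) (m n : nat) : m%:R * n%:R < 2 :> R ->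
  log2 (m%:R * n%:R : R) = 0.
Proof.
rewrite -natrM ltr_nat; case: (m * n)%N => [|[|k]] //= _.
  by rewrite /log2 ln0 ?mul0r.
by rewrite /log2 ln1 mul0r.
Qed.

Lemma sumset_lower_bounds (R : realType) (K alpha c c' : R) (A B : {fset R}) :
  0 < K -> 1 <= alpha -> 0 < c -> 0 < c' ->
  szt_bound K alpha c A -> szt_bound K alpha c' B ->
  let a : R := #|` A|%:R in
  let a' : R := #|` B|%:R in
  let s : R := #|` sumset A B|%:R in
  let L : R := log2 (a * a') in
  let q : R := alpha ^+ 2 + 4 * alpha - 3 in
      [/\ s >=
            lower_const K * (Num.min
              (c' `^ (- (2 / (3 * (7 + alpha))))
               * c `^ (- (13 / (3 * (7 + alpha))))
               * a' `^ (2 * (24 - alpha) / (3 * (7 + alpha)))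
               * a `^ ((33 - 10 * alpha) / (3 * (7 + alpha))))
              (c `^ (- (2 / (3 * (7 + alpha))))
               * c' `^ (- (13 / (3 * (7 + alpha))))
               * a `^ (2 * (24 - alpha) / (3 * (7 + alpha)))
               * a' `^ ((33 - 10 * alpha) / (3 * (7 + alpha))))
             * L `^ (- (2 / (7 + alpha)))),
          1 < alpha ->
          s >=
            lower_const2 K ((alpha - 1)^-1) *
             (c `^ (- ((4 * alpha - 2) / (3 * q)))
              * c' `^ (- ((7 * alpha - 5) / (3 * q)))
              * a `^ ((28 * alpha - 4 * alpha ^+ 2 - 16) / (3 * q))
              * a' `^ ((35 * alpha - 4 * alpha ^+ 2 - 21) / (3 * q))
              * L `^ (- (2 * (alpha - 1) / q))),
          alpha = 2 ->
          s >=
            lower_const K * (Num.max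
              (Num.max
                (c' `^ (- (1 / 3)) * c `^ (- (2 / 9))
                 * a' `^ (11 / 9) * a `^ (8 / 9))
                (c `^ (- (1 / 3)) * c' `^ (- (2 / 9))
                 * a `^ (11 / 9) * a' `^ (8 / 9)))
              (Num.min
                (c' `^ (- (2 / 27)) * c `^ (- (13 / 27))
                 * a' `^ (44 / 27) * a `^ (13 / 27))
                (c `^ (- (2 / 27)) * c' `^ (- (13 / 27))
                 * a `^ (44 / 27) * a' `^ (13 / 27)))
             * L `^ (- (2 / 9)))
        & s `^ ((alpha + 1) / 2) * #|` diffset A A|%:R >=
            lower_const K * (a `^ ((33 - 4 * alpha) / 6) * a' `^ ((6 - alpha) / 3)
                 * c `^ (- (7 / 6)) * c' `^ (- (1 / 3)) * L^-1)].
Proof.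
move=> K0 al1 c0 c'0 hA hB a a' s L q.
(* When the product of the cardinalities is 0 or 1, [L = 0]; its negative powers and its inverse are
   0 by convention, so every lower bound is 0. *)
have [ab2|ab2] := leP 2 (a * a'); last first.
  have L0 : L = 0 by exact: log2_lt2.
  have q0 : 0 < q := exponent_quad_gt0 al1.
  have z e : 0 < e -> (0 : R) `^ (- e) = 0.
    by move=> e0; rewrite powR0 // oppr_eq0 gt_eqF.
  have s0 : 0 <= s by exact: ler0n.
  rewrite L0 invr0; split; last by rewrite !mulr0 mulr_ge0 ?powR_ge0.
  - by rewrite z ?mulr0 // divr_gt0 // exponent_den_gt0.
  - by move=> al; rewrite z ?mulr0 // divr_gt0 // mulr_gt0 // subr_gt0.
  - by move=> _; rewrite z ?mulr0 // divr_gt0.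
have sC : #|` sumset B A|%:R = s by rewrite sumsetC.
have ba2 : 2 <= a' * a by rewrite mulrC.
have LC : log2 (a' * a) = L by rewrite mulrC.
have C0 : 0 <= lower_const K by exact: expR_ge0.
have bC0 x y z : 0 <= z -> x <= y ->
    lower_const K * (x * z) <= lower_const K * (y * z).
  by move=> z0 xy; rewrite ler_wpM2l // ler_wpM2r.
have h1 : lower_const K * (Num.min
    (c' `^ (- (2 / (3 * (7 + alpha)))) * c `^ (- (13 / (3 * (7 + alpha))))
     * a' `^ (2 * (24 - alpha) / (3 * (7 + alpha)))
     * a `^ ((33 - 10 * alpha) / (3 * (7 + alpha))))
    (c `^ (- (2 / (3 * (7 + alpha)))) * c' `^ (- (13 / (3 * (7 + alpha))))
     * a `^ (2 * (24 - alpha) / (3 * (7 + alpha)))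
     * a' `^ ((33 - 10 * alpha) / (3 * (7 + alpha))))
    * L `^ (- (2 / (7 + alpha)))) <= s.
  (* One of the two energies is large: otherwise [s ^+ 2 * (energy A A * energy B B)] would be below
     [(a * a') ^+ 4], against [energy_cauchy] and [energy_ge]. Each case yields one argument of the
     minimum. *)
  have [hE|hE] := leP ((a * a') ^+ 2) (s * energy A A).
    apply: le_trans (sumset_ge_of_energy K0 al1 c0 c'0 hA hB ab2 hE).
    by apply: bC0; rewrite ?powR_ge0 // ge_min lexx.
  have hE' : (a' * a) ^+ 2 <= #|` sumset B A|%:R * energy B B.
    rewrite sC [a' * a]mulrC leNgt; apply/negP => hE2.
    have : (s * energy A A) * (s * energy B B) < (a * a') ^+ 2 * (a * a') ^+ 2.
      by apply: ltr_pM => //; rewrite mulr_ge0 ?energy_ge0 // ler0n.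
    apply/negP; rewrite -leNgt.
    have -> : s * energy A A * (s * energy B B) = s ^+ 2 * (energy A A * energy B B).
      by ring.
    apply: le_trans (ler_wpM2l (exprn_ge0 2 (ler0n _ _)) (energy_cauchy A B)).
    rewrite -expr2 -exprMn ler_sqr ?nnegrE ?exprn_ge0 ?mulr_ge0 ?energy_ge0 ?ler0n //.
    exact: energy_ge.
  have := sumset_ge_of_energy K0 al1 c'0 c0 hB hA ba2 hE'.
  rewrite sC LC; apply: le_trans.
  by apply: bC0; rewrite ?powR_ge0 // ge_min lexx orbT.
split => //.
- by move=> al; exact: sumset_ge2.
- move=> al2; have max_le x y z : lower_const K * (x * z) <= s ->
      lower_const K * (y * z) <= s -> lower_const K * (Num.max x y * z) <= s.
    by rewrite /Num.max; case: ifP.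
  (* The first two arguments are the second bound at alpha = 2 for the pair and for the swapped
     pair; the third is the first bound at alpha = 2. *)
  apply: (max_le); first apply: max_le.
  + exact: (sumset_ge2_at2 K0 al1 c0 c'0 hA hB ab2 al2).
  + have := sumset_ge2_at2 K0 al1 c'0 c0 hB hA ba2 al2.
    by rewrite sC LC.
  have e1 : 2 / (3 * (7 + 2)) = 2 / 27 :> R by field.
  have e2 : 13 / (3 * (7 + 2)) = 13 / 27 :> R by field.
  have e3 : 2 * (24 - 2) / (3 * (7 + 2)) = 44 / 27 :> R by field.
  have e4 : (33 - 10 * 2) / (3 * (7 + 2)) = 13 / 27 :> R by field.
  have e5 : 2 / (7 + 2) = 2 / 9 :> R by field.
  by move: h1; rewrite al2 e1 e2 e3 e4 e5.
- exact: sumset_diffset_ge.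
Qed.

Theorem theorem6 (R : realType) (K : R) (hK : 0 < K) :
  exists (C : R) (D : R -> R),
    [/\ 0 < C, forall t : R, 0 < t -> 0 < D t &
    forall (alpha c c' : R) (A A' X : {fset R}),
      SzT_type K alpha c A -> SzT_type K alpha c' A' ->
      X = sumset A A' \/ X = diffset A A' ->
      let a : R := #|` A|%:R in
      let a' : R := #|` A'|%:R in
      let L : R := log2 (a * a') in
      let q : R := alpha ^+ 2 + 4 * alpha - 3 in
      [/\ #|` X|%:R >=
            C * (Num.min
              (c' `^ (- (2 / (3 * (7 + alpha))))
               * c `^ (- (13 / (3 * (7 + alpha))))
               * a' `^ (2 * (24 - alpha) / (3 * (7 + alpha)))
               * a `^ ((33 - 10 * alpha) / (3 * (7 + alpha))))
              (c `^ (- (2 / (3 * (7 + alpha))))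
               * c' `^ (- (13 / (3 * (7 + alpha))))
               * a `^ (2 * (24 - alpha) / (3 * (7 + alpha)))
               * a' `^ ((33 - 10 * alpha) / (3 * (7 + alpha))))
             * L `^ (- (2 / (7 + alpha)))),
          1 < alpha ->
          #|` X|%:R >=
            D ((alpha - 1)^-1) *
             (c `^ (- ((4 * alpha - 2) / (3 * q)))
              * c' `^ (- ((7 * alpha - 5) / (3 * q)))
              * a `^ ((28 * alpha - 4 * alpha ^+ 2 - 16) / (3 * q))
              * a' `^ ((35 * alpha - 4 * alpha ^+ 2 - 21) / (3 * q))
              * L `^ (- (2 * (alpha - 1) / q))),
          alpha = 2 ->
          #|` X|%:R >=
            C * (Num.max
              (Num.max
                (c' `^ (- (1 / 3)) * c `^ (- (2 / 9))
                 * a' `^ (11 / 9) * a `^ (8 / 9))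
                (c `^ (- (1 / 3)) * c' `^ (- (2 / 9))
                 * a `^ (11 / 9) * a' `^ (8 / 9)))
              (Num.min
                (c' `^ (- (2 / 27)) * c `^ (- (13 / 27))
                 * a' `^ (44 / 27) * a `^ (13 / 27))
                (c `^ (- (2 / 27)) * c' `^ (- (13 / 27))
                 * a `^ (44 / 27) * a' `^ (13 / 27)))
             * L `^ (- (2 / 9)))
        & #|` X|%:R `^ ((alpha + 1) / 2) * #|` diffset A A|%:R >=
            C * (a `^ ((33 - 4 * alpha) / 6) * a' `^ ((6 - alpha) / 3)
                 * c `^ (- (7 / 6)) * c' `^ (- (1 / 3)) * L^-1)]].
Proof.
exists (lower_const K), (lower_const2 K); split => [|t _|]; try exact: expR_gt0.
move=> alpha c c' A A' X hA hA' hX a a' L q.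
have [al1 c0 _] := hA; have [_ c'0 _] := hA'.
have bA := SzT_type_bound hK hA; have bA' := SzT_type_bound hK hA'.
case: hX => ->; first exact: sumset_lower_bounds.
(* The difference set is the sumset of [A] and the reflection of [A'], which has the same
   cardinality and the same Szemeredi-Trotter constant. *)
rewrite diffset_sumset /L /a' -(card_oppset A').
exact: sumset_lower_bounds (szt_bound_oppset bA').
Qed.
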